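(* Let $p>2$ and $0<\lambda<\Lambda$ be fixed, let $\Omega\subset\mathbb{R}^n$ be a bounded domain satisfying uniform interior and exterior sphere conditions, and let $u_0\in C^1(\overline{\Omega})$ satisfy $u_0\ge 0$ in $\overline\Omega$ and $u_0=0$ on $\partial\Omega$. Then there exists $T^*>0$, depending only on $\Lambda,\lambda,n,\Omega$ and $\|u_0\|_{C^1(\overline{\Omega})}$ (the exponent $p$ being fixed), such that the viscosity solution $u$ of $$u_t-\mathcal{M}^-(D^2u)=|Du|^p \quad\text{in }\Omega\times(0,T^* )$$ with boundary condition $u=0$ on $\partial\Omega\times(0,T^* )$ (understood in the viscosity sense) and initial condition $u(\cdot,0)=u_0$ satisfies both conditions in the classical sense: $u(x,t)=0$ for all $(x,t)\in\partial\Omega\times(0,T^* )$ and $u(x,0)=u_0(x)$ for all $x\in\overline\Omega$.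
   Context: $S(n)$ denotes the real symmetric $n\times n$ matrices with the usual ordering. For $0<\lambda<\Lambda$ and $X\in S(n)$, Pucci's minimal operator is $\mathcal{M}^-(X)=\inf\{\mathrm{tr}(AX): A\in S(n),\ \lambda I\le A\le\Lambda I\}$. Uniform interior (exterior) sphere condition: there is a radius $\eta>0$ such that for every $x_0\in\partial\Omega$ there is an open ball of radius $\eta$ contained in $\Omega$ (respectively in $\mathbb{R}^n\setminus\overline\Omega$) whose boundary contains $x_0$. A viscosity solution of the generalized Dirichlet problem is a continuous function $u$ on $\overline\Omega\times[0,T)$ which is a viscosity solution of the equation in $\Omega\times(0,T)$, satisfies $u(\cdot,0)=u_0$ pointwise on $\overline\Omega$, and satisfies $u=0$ on $\partial\Omega\times(0,T)$ in the viscosity sense, that is: at points of $\partial\Omega\times(0,T)$, $$\min\big(u_t-\mathcal{M}^-(D^2u)-|Du|^p,\,u\big)\le 0\quad\text{and}\quad \max\big(u_t-\mathcal{M}^-(D^2u)-|Du|^p,\,u\big)\ge 0$$ hold in the viscosity sense (the first with derivatives replaced by those of any smooth test function touching $u$ from above at the point relative to $\overline\Omega\times(0,T)$, the second with those of any smooth test function touching $u$ from below). It is known that this problem has a unique globally defined continuous viscosity solution. *)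

(* Defs.v *)
From HB Require Import structures.
From mathcomp Require Import all_boot all_order all_algebra.
From mathcomp Require Import all_classical all_reals all_analysis.

Set Implicit Arguments.
Unset Strict Implicit.
Unset Printing Implicit Defensive.

Import Order.TTheory GRing.Theory Num.Theory.
Import numFieldNormedType.Exports.

Local Open Scope classical_set_scope.
Local Open Scope ring_scope.

Section Geometry.
Context {R : realType} {n : nat}.
Implicit Types (x y : 'rV[R]_n) (A Omega : set 'rV[R]_n).

(* The library norm `|x| on 'rV[R]_n is the maximum norm; it induces the usual
   topology and bounded sets, but Euclidean balls and lengths need this one. *)
Definition enorm x : R := Num.sqrt (\sum_i x 0 i ^+ 2).

Definition eball x (r : R) : set 'rV[R]_n := [set y | enorm (y - x) < r].

Definition boundary A : set 'rV[R]_n := closure A `\` A°.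

Definition bounded_domain Omega : Prop :=
  [/\ open Omega, connected Omega, Omega !=set0 & bounded_set Omega].

Definition uniform_interior_sphere Omega : Prop :=
  exists2 eta : R, 0 < eta & forall x0, boundary Omega x0 ->
    exists2 y, eball y eta `<=` Omega & boundary (eball y eta) x0.

Definition uniform_exterior_sphere Omega : Prop :=
  exists2 eta : R, 0 < eta & forall x0, boundary Omega x0 ->
    exists2 y, eball y eta `<=` ~` closure Omega & boundary (eball y eta) x0.

Definition gradient (f : 'rV[R]_n -> R) x : 'rV[R]_n :=
  \row_i 'D_(delta_mx 0 i) f x.

(* f is continuous on closure Omega, differentiable in Omega, and its gradient
   extends continuously to closure Omega (the extension being g). *)
Definition C1_closure Omega (f : 'rV[R]_n -> R) : Prop :=
  [/\ {within closure Omega, continuous f},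
      (forall x, Omega x -> differentiable f x) &
      exists2 g : 'rV[R]_n -> 'rV[R]_n,
        {within closure Omega, continuous g} &
        forall x, Omega x -> gradient f x = g x].

(* Outside Omega the gradient of f depends on arbitrary values of f off
   closure Omega.  The supremum over Omega equals the supremum over
   closure Omega of the continuous extension. *)
Definition C1_norm Omega (f : 'rV[R]_n -> R) : R :=
  sup [set `|f x| | x in closure Omega] +
  sup [set enorm (gradient f x) | x in Omega].

End Geometry.

Section Pucci.
Context {R : realType} {n : nat}.
Implicit Types A X Y : 'M[R]_n.

Definition mx_le X Y : Prop :=
  forall v : 'rV[R]_n, (v *m X *m v^T) 0 0 <= (v *m Y *m v^T) 0 0.

Definition pucci_min (lambda Lambda : R) X : R :=
  inf [set \tr (A *m X) | A in
    [set A | [/\ A^T = A, mx_le lambda%:M A & mx_le A Lambda%:M]]].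

End Pucci.

Section Viscosity.
Context {R : realType} {n : nat}.

Local Notation spacetime := ('rV[R]_n * R)%type.

Implicit Types (phi u : spacetime -> R) (z : spacetime).

(* For k > 0 the continuity of phi itself follows, the space being of finite
   dimension. *)
Fixpoint Ck (k : nat) phi : Prop :=
  if k is k'.+1 then
    forall v : spacetime, (forall z, derivable phi z v) /\ Ck k' ('D_v phi)
  else continuous phi.

Definition smooth phi : Prop := forall k, Ck k phi.

Definition space_dir (i : 'I_n) : spacetime := (delta_mx 0 i, 0).

Definition time_dir : spacetime := (0, 1).

Definition space_gradient phi z : 'rV[R]_n := \row_i 'D_(space_dir i) phi z.

Definition space_hessian phi z : 'M[R]_n :=
  \matrix_(i, j) 'D_(space_dir i) ('D_(space_dir j) phi) z.

(* phi_t - M^-(D^2 phi) - |D phi|^p at z *)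
Definition parabolic_op (p lambda Lambda : R) phi z : R :=
  'D_time_dir phi z - pucci_min lambda Lambda (space_hessian phi z)
  - enorm (space_gradient phi z) `^ p.

Definition touches_above (D : set spacetime) u phi z : Prop :=
  phi z = u z /\ \forall y \near within D (nbhs z), u y <= phi y.

Definition touches_below (D : set spacetime) u phi z : Prop :=
  phi z = u z /\ \forall y \near within D (nbhs z), phi y <= u y.

Definition viscosity_equation (p lambda Lambda : R) (Omega : set 'rV[R]_n)
    (T : R) u : Prop :=
  let D := Omega `*` `]0, T[%classic in
  forall z, D z -> forall phi, smooth phi ->
    (touches_above D u phi z -> parabolic_op p lambda Lambda phi z <= 0) /\
    (touches_below D u phi z -> 0 <= parabolic_op p lambda Lambda phi z).

Definition viscosity_zero_boundary (p lambda Lambda : R)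
    (Omega : set 'rV[R]_n) (T : R) u : Prop :=
  let D := closure Omega `*` `]0, T[%classic in
  forall z, (boundary Omega `*` `]0, T[%classic) z -> forall phi, smooth phi ->
    (touches_above D u phi z ->
       Num.min (parabolic_op p lambda Lambda phi z) (u z) <= 0) /\
    (touches_below D u phi z ->
       0 <= Num.max (parabolic_op p lambda Lambda phi z) (u z)).

Definition viscosity_solution (p lambda Lambda : R) (Omega : set 'rV[R]_n)
    (T : R) (u0 : 'rV[R]_n -> R) u : Prop :=
  [/\ {within closure Omega `*` `[0, T[%classic, continuous u},
      viscosity_equation p lambda Lambda Omega T u,
      viscosity_zero_boundary p lambda Lambda Omega T u &
      forall x, closure Omega x -> u (x, 0) = u0 x].

End Viscosity.

(* Main.v *)
Require Import Defs.
From HB Require Import structures.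
From mathcomp Require Import all_boot all_order all_algebra.
From mathcomp Require Import all_classical all_reals all_analysis.
From mathcomp Require Import ring lra.

Set Implicit Arguments.
Unset Strict Implicit.
Unset Printing Implicit Defensive.

Import Order.TTheory GRing.Theory Num.Theory.
Import numFieldNormedType.Exports.

Local Open Scope classical_set_scope.
Local Open Scope ring_scope.

(** The boundary values can fail only by detaching: at a boundary point where
    [u > 0] the viscosity boundary condition says no more than that [u] is a
    subsolution there.  Hence [u] stays below every smooth strict
    supersolution which is nonnegative on the boundary and dominates [u0] at
    time 0, and for the same reason [u] stays above the subsolution 0.  It is
    enough to find, for each boundary point [x0], such a supersolution that
    vanishes at [x0] up to a time independent of [x0].

    Let [y] be the centre of the exterior ball of radius [eta] touching at
    [x0], and let [s = |x - y|^2 - eta^2], which is nonnegative on the closure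
    of [Omega] and vanishes at [x0].  The barrier is
      [psi = k s + (1 - exp (- b s)) / b + C t s].
    Its slope in [s] stays between [k] and [k + 2] as long as [C t <= 1], so
    that [|D psi|^p] and the part of the Hessian carried by the slope are
    bounded by a constant [Q] in which [b] and [C] do not enter.  This [Q] is
    paid for in two regions: where [b s <= 1] by the concavity of the
    exponential term, which contributes at least [4 lambda eta^2 b / e], and
    where [b s >= 1] by the time derivative [C s >= C / b].  Choosing [b], then
    [C], large in terms of [Q] makes [psi] a supersolution up to time [1 / C].
    The initial comparison [u0 <= k s] holds with [k = M / (2 eta)], because
    [u0] vanishes where the segment from [x] to [y] first leaves [Omega], at
    distance at most [|x - y| - eta] from [x].

    The Pucci operator enters through one inequality: [M^-] is an infimum over
    matrices which include [lambda I], hence at most [lambda] times the trace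
    ([pucci_min_le_trace]).

    The comparison itself ([viscosity_solution_ge0],
    [viscosity_solution_le_barrier]) is the classical maximum principle; the
    term [a * exp (N t)] with [N] large keeps the maximum away from the final
    time and makes the inequality strict ([penalized_max]). *)

(** * Smooth test functions *)

Section DirectionalDerivatives.
Context {R : realType} {V : normedModType R}.
Implicit Types (f g : V -> R) (x v : V).

(** Reduces a directional derivative to a derivative in one real variable,
    where the chain rule is available. *)
Lemma is_derive_line f x v (df : R) :
  is_derive x v f df <-> is_derive (0 : R) 1 (fun h : R => f (h *: v + x)) df.
Proof.
have E : 'D_1 (fun h : R => f (h *: v + x)) (0 : R) = 'D_v f x.
  rewrite /derive; set g1 := (X in lim (X @ _)).
  set g2 := (X in _ = lim (X @ _)); suff -> : g1 = g2 by [].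
  by apply/funext => h; rewrite /g1 /g2 /= addr0 scale0r add0r [_%:A]mulr1.
split=> -[d <-]; split; rewrite ?E //; first by apply: (derivable1P f x v).1.
by apply: (derivable1P f x v).2.
Qed.

Lemma is_derive_expR_comp f x v (df : R) :
  is_derive x v f df -> is_derive x v (fun y => expR (f y)) (expR (f x) * df).
Proof.
move=> /is_derive_line fx; apply/is_derive_line.
apply: (@is_derive1_comp R expR (fun h : R => f (h *: v + x))) => //.
by rewrite scale0r add0r; exact: is_derive_expR.
Qed.

(** Sums and products written pointwise, so that the derivative of an expression
    is assembled along its syntax. *)
Lemma is_derive_add f g x v (df dg : R) :
  is_derive x v f df -> is_derive x v g dg ->
  is_derive x v (fun y => f y + g y) (df + dg).
Proof. by move=> *; exact: is_deriveD. Qed.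

Lemma is_derive_mul f g x v (df dg : R) :
  is_derive x v f df -> is_derive x v g dg ->
  is_derive x v (fun y => f y * g y) (f x * dg + g x * df).
Proof. by move=> *; exact: is_deriveM. Qed.

End DirectionalDerivatives.

Section SmoothExpressions.
Context {R : realType} {n : nat}.
Local Notation spacetime := ('rV[R]_n * R)%type.
Implicit Types (f g : spacetime -> R) (z v : spacetime).

(** Smoothness of a test function is a statement about all its iterated
    directional derivatives, so it is proved for a class of functions that
    directional differentiation maps into itself. *)
Inductive smooth_expr : (spacetime -> R) -> Prop :=
| se_cst c : smooth_expr (fun=> c)
| se_coord i : smooth_expr (fun z => z.1 0 i)
| se_time : smooth_expr (fun z => z.2)
| se_add f g : smooth_expr f -> smooth_expr g ->
    smooth_expr (fun z => f z + g z)
| se_mul f g : smooth_expr f -> smooth_expr g ->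
    smooth_expr (fun z => f z * g z)
| se_exp f : smooth_expr f -> smooth_expr (fun z => expR (f z)).

Lemma is_derive_coord z v i :
  is_derive z v (fun z : spacetime => z.1 0 i) (v.1 0 i).
Proof.
apply/is_derive_line.
have -> : (fun h : R => (h *: v + z).1 0 i) =
          (fun h => h * v.1 0 i) + cst (z.1 0 i).
  by apply/funext => h /=; rewrite !mxE.
have D := is_deriveM (is_derive_id (0 : R) 1)
  (is_derive_cst (v.1 0 i) (0 : R) 1).
have := is_deriveD D (is_derive_cst (z.1 0 i) (0 : R) 1).
by rewrite scaler0 add0r addr0 /GRing.scale /= mulr1.
Qed.

Lemma is_derive_time z v :
  is_derive z v (fun z : spacetime => z.2) v.2.
Proof.
apply/is_derive_line.
have -> : (fun h : R => (h *: v + z).2) = (fun h => h * v.2) + cst z.2.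
  by apply/funext => h.
have D := is_deriveM (is_derive_id (0 : R) 1) (is_derive_cst v.2 (0 : R) 1).
have := is_deriveD D (is_derive_cst z.2 (0 : R) 1).
by rewrite scaler0 add0r addr0 /GRing.scale /= mulr1.
Qed.

Lemma smooth_expr_derive f v : smooth_expr f ->
  exists2 df, smooth_expr df & forall z, is_derive z v f (df z).
Proof.
elim=> [c|i||{}f g _ [df sf Df] sg [dg sdg Dg]
       |{}f g sf [df sdf Df] sg [dg sdg Dg]
       |{}f sf [df sdf Df]].
- by exists (fun=> 0); [exact: se_cst | move=> z; exact: is_derive_cst].
- exists (fun=> v.1 0 i); [exact: se_cst | move=> z; exact: is_derive_coord].
- exists (fun=> v.2); [exact: se_cst | move=> z; exact: is_derive_time].
- exists (fun z => df z + dg z); first exact: se_add.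
  by move=> z; exact: is_derive_add.
- exists (fun z => f z * dg z + g z * df z).
    by apply: se_add; exact: se_mul.
  by move=> z; exact: is_derive_mul.
- exists (fun z => expR (f z) * df z); first by apply: se_mul => //; exact: se_exp.
  by move=> z; exact: is_derive_expR_comp.
Qed.

Lemma smooth_expr_continuous f : smooth_expr f -> continuous f.
Proof.
elim=> [c|i||{}f g _ cf _ cg|{}f g _ cf _ cg|{}f _ cf] z.
- exact: cvg_cst.
- apply: (@continuous_comp _ _ _ fst (fun x : 'rV[R]_n => x 0 i)).
    exact: cvg_fst.
  exact: coord_continuous.
- exact: cvg_snd.
- by apply: cvgD; [exact: cf|exact: cg].
- by apply: cvgM; [exact: cf|exact: cg].
- apply: (@continuous_comp _ _ _ f expR); first exact: cf.
  exact: continuous_expR.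
Qed.

Lemma smooth_expr_smooth f : smooth_expr f -> smooth f.
Proof.
move=> sf k; elim: k f sf => [|k IH] f sf; first exact: smooth_expr_continuous.
move=> v; have [df sdf Df] := smooth_expr_derive v sf.
split=> [z|]; first by case: (Df z).
have -> : 'D_v f = df by apply/funext => z; exact: (@derive_val _ _ _ _ _ _ _ (Df z)).
exact: IH.
Qed.

End SmoothExpressions.

(** * Upper bound for the Pucci operator *)

Section PucciBound.
Context {R : realType} {n : nat}.
Implicit Types A X : 'M[R]_n.

(** The values of the quadratic form on sums of two basis vectors determine
    every entry of a symmetric matrix. *)
Lemma quad_form_delta A i j :
  let v : 'rV[R]_n := delta_mx 0 i + delta_mx 0 j in
  (v *m A *m v^T) 0 0 = A i i + A i j + A j i + A j j.
Proof.
have E k l : ((delta_mx 0 k : 'rV[R]_n) *m A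
    *m (delta_mx 0 l : 'rV[R]_n)^T) 0 0 = A k l.
  by rewrite trmx_delta -rowE -colE !mxE.
rewrite /= linearD /= mulmxDl !mulmxDr !mulmxDl mxE [in LHS]mxE [X in _ + X]mxE.
by rewrite !E; ring.
Qed.

Lemma entry_bound (lambda Lambda : R) A i j :
  0 <= lambda -> lambda <= Lambda ->
  A^T = A -> mx_le lambda%:M A -> mx_le A Lambda%:M ->
  `|A i j| <= 2 * Lambda.
Proof.
move=> l0 lL sA lA AL.
have sym : A j i = A i j by rewrite -[in LHS]sA mxE.
have L0 : 0 <= Lambda by exact: le_trans lL.
have := lA (delta_mx 0 i + delta_mx 0 j).
have := AL (delta_mx 0 i + delta_mx 0 j).
have := AL (delta_mx 0 i + delta_mx 0 i).
have := AL (delta_mx 0 j + delta_mx 0 j).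
have := lA (delta_mx 0 i + delta_mx 0 i).
have := lA (delta_mx 0 j + delta_mx 0 j).
rewrite !quad_form_delta !mxE !eqxx sym (eq_sym j i) ler_norml.
case: (i == j); rewrite /= ?mulr1n ?mulr0n => *; apply/andP; split; lra.
Qed.

Lemma scalar_mx_le (a b : R) : a <= b -> mx_le (a%:M : 'M[R]_n) b%:M.
Proof.
move=> ab v; rewrite !mul_mx_scalar -!scalemxAl !mxE ler_wpM2r //.
by apply: sumr_ge0 => i _; rewrite !mxE -expr2 sqr_ge0.
Qed.

(** The right-hand side is the competitor [lambda I].  The entry bound is what
    makes the set bounded below, so that its infimum is a genuine one. *)
Lemma pucci_min_le_trace (lambda Lambda : R) X :
  0 <= lambda -> lambda <= Lambda ->
  pucci_min lambda Lambda X <= lambda * \tr X.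
Proof.
move=> l0 lL; apply: ge_inf; last first.
  exists lambda%:M; last by rewrite mul_scalar_mx mxtraceZ.
  by split; [exact: tr_scalar_mx | exact: scalar_mx_le | exact: scalar_mx_le].
exists (- \sum_i \sum_j 2 * Lambda * `|X j i|) => _ [A [sA lA AL] <-].
rewrite /mxtrace -sumrN; apply: ler_sum => i _; rewrite !mxE -sumrN.
apply: ler_sum => j _; rewrite lerNl (le_trans (ler_norm _)) // normrN normrM.
by rewrite ler_wpM2r // (entry_bound _ _ l0 lL).
Qed.

Lemma pucci_min0 (lambda Lambda : R) : 0 <= lambda -> lambda <= Lambda ->
  pucci_min lambda Lambda (0 : 'M[R]_n) = 0.
Proof.
move=> l0 lL; rewrite /pucci_min (_ : [set _ | _ in _] = [set 0]) ?inf1 //.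
apply/seteqP; split=> x /=.
  by move=> [A _ <-]; rewrite mulmx0 linear0.
move=> ->; exists lambda%:M; last by rewrite mulmx0 linear0.
by split; [exact: tr_scalar_mx | exact: scalar_mx_le | exact: scalar_mx_le].
Qed.

End PucciBound.

(** * Euclidean norm *)

Section EuclideanNorm.
Context {R : realType} {n : nat}.
Implicit Types x y : 'rV[R]_n.

Definition sqdist y x : R := \sum_i (x 0 i - y 0 i) ^+ 2.

Lemma enorm_ge0 x : 0 <= enorm x.
Proof. exact: sqrtr_ge0. Qed.

Lemma sqr_enorm x : enorm x ^+ 2 = \sum_i x 0 i ^+ 2.
Proof. by rewrite sqr_sqrtr // sumr_ge0 // => i _; rewrite sqr_ge0. Qed.

Lemma enorm_eq0 x : enorm x = 0 -> x = 0.
Proof.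
move=> x0; have /eqP : \sum_i x 0 i ^+ 2 = 0 by rewrite -sqr_enorm x0 expr0n.
rewrite psumr_eq0 => [/allP xi|i _]; last exact: sqr_ge0.
apply/rowP => i; rewrite mxE; apply/eqP; rewrite -sqrf_eq0.
exact: (implyP (xi i (mem_index_enum i))).
Qed.

Lemma enormZ (c : R) x : 0 <= c -> enorm (c *: x) = c * enorm x.
Proof.
move=> c0; rewrite /enorm; under eq_bigr do rewrite mxE exprMn.
by rewrite -mulr_sumr sqrtrM ?sqr_ge0 // sqrtr_sqr ger0_norm.
Qed.

Lemma sqdistE y x : sqdist y x = enorm (x - y) ^+ 2.
Proof. by rewrite sqr_enorm; apply: eq_bigr => i _; rewrite !mxE. Qed.

(** Cauchy-Schwarz: expand the square of [enorm y *: x - enorm x *: y]. *)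
Lemma dot_le_enorm x y : \sum_i x 0 i * y 0 i <= enorm x * enorm y.
Proof.
have [/eqP x0|x0] := boolP (enorm x == 0).
  rewrite x0 mul0r (enorm_eq0 x0) big1 // => i _; by rewrite mxE mul0r.
have [/eqP y0|y0] := boolP (enorm y == 0).
  rewrite y0 mulr0 (enorm_eq0 y0) big1 // => i _; by rewrite mxE mulr0.
have X0 : 0 < enorm x by rewrite lt0r x0 enorm_ge0.
have Y0 : 0 < enorm y by rewrite lt0r y0 enorm_ge0.
have : 0 <= \sum_i (enorm y * x 0 i - enorm x * y 0 i) ^+ 2.
  by apply: sumr_ge0 => i _; rewrite sqr_ge0.
rewrite (eq_bigr (fun i => enorm y ^+ 2 * x 0 i ^+ 2 + enorm x ^+ 2 * y 0 i ^+ 2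
   - 2 * enorm x * enorm y * (x 0 i * y 0 i))); last by move=> i _; ring.
rewrite big_split /= big_split /= sumrN -!mulr_sumr -!sqr_enorm.
by move=> h; rewrite -(ler_pM2l (mulr_gt0 X0 Y0)); lra.
Qed.

Lemma enorm_le x (r : R) : 0 <= r -> (\sum_i x 0 i ^+ 2) <= r ^+ 2 ->
  enorm x <= r.
Proof.
by move=> r0 xr; rewrite /enorm -(ger0_norm r0) -sqrtr_sqr ler_wsqrtr.
Qed.

Lemma enorm_le_entry x (c : R) : (forall i, `|x 0 i| <= c) -> 0 <= c ->
  enorm x <= n%:R * c.
Proof.
move=> xc c0; apply: enorm_le; first exact: mulr_ge0.
apply: (@le_trans _ _ (\sum_(i < n) c ^+ 2)).
  by apply: ler_sum => i _; rewrite -real_normK ?num_real // ler_sqr ?nnegrE.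
rewrite sumr_const card_ord exprMn -[leLHS]mulr_natl ler_wpM2r ?sqr_ge0 //.
by rewrite -natrX ler_nat; case: (n) => // m; rewrite expnS expn1 leq_pmulr.
Qed.

Lemma entry_le_norm x i : `|x 0 i| <= `|x|.
Proof.
rewrite [leRHS]mx_normrE.
exact: (le_bigmax _ (fun ij : 'I_1 * 'I_n => `|x ij.1 ij.2|) (0, i)).
Qed.

End EuclideanNorm.

(** * The barrier *)

Section SmoothClosure.
Context {R : realType} {n : nat}.
Local Notation spacetime := ('rV[R]_n * R)%type.
Implicit Types (f g : spacetime -> R).

Lemma se_opp f : smooth_expr f -> smooth_expr (fun z => - f z).
Proof.
move=> sf; have -> : (fun z => - f z) = (fun z => (-1) * f z).
  by apply/funext => z; rewrite mulN1r.
exact: se_mul (se_cst _) sf.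
Qed.

Lemma se_sum (h : 'I_n -> spacetime -> R) :
  (forall i, smooth_expr (h i)) -> smooth_expr (fun z => \sum_i h i z).
Proof.
move=> sh; elim: (index_enum _) => [|i r IH].
  have -> : (fun z => \sum_(i <- [::]) h i z) = fun=> 0.
    by apply/funext => z; rewrite big_nil.
  exact: se_cst.
have -> : (fun z => \sum_(j <- i :: r) h j z) =
    (fun z => h i z + \sum_(j <- r) h j z).
  by apply/funext => z; rewrite big_cons.
exact: se_add.
Qed.

End SmoothClosure.

Section Barrier.
Context {R : realType} {n : nat}.
Local Notation spacetime := ('rV[R]_n * R)%type.
Implicit Types (x y : 'rV[R]_n) (z v : spacetime).

(** A function of [s = |x - y|^2 - eta^2] and time: the linear part dominates
    the initial datum, the exponential part is strongly concave near the
    sphere [s = 0], and the last part grows in time away from it. *)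
Definition barrier (eta k b C : R) y z : R :=
  let s := sqdist y z.1 - eta ^+ 2 in
  k * s + (1 - expR (- (b * s))) / b + C * z.2 * s.

Definition time_penalty (a N : R) z : R := a * expR (N * z.2).

(** The partial derivative of the barrier with respect to [s]. *)
Definition barrier_slope (eta k b C : R) y z : R :=
  k + expR (- (b * (sqdist y z.1 - eta ^+ 2))) + C * z.2.

Lemma smooth_sqdist y : smooth_expr (fun z => sqdist y z.1).
Proof.
apply: se_sum => i; rewrite [X in smooth_expr X](_ : _ =
  fun z => (z.1 0 i - y 0 i) * (z.1 0 i - y 0 i)) //.
by apply: se_mul; apply: se_add (se_coord i) (se_cst _).
Qed.

Lemma smooth_barrier eta k b C y : smooth_expr (barrier eta k b C y).
Proof.
have ss : smooth_expr (fun z => sqdist y z.1 - eta ^+ 2).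
  exact: se_add (smooth_sqdist y) (se_cst _).
rewrite /barrier /=; apply: se_add; [apply: se_add|].
- exact: se_mul (se_cst _) ss.
- apply: se_mul (se_cst _); apply: se_add (se_cst _) _.
  exact/se_opp/se_exp/se_opp/(se_mul (se_cst _) ss).
- exact: se_mul (se_mul (se_cst _) se_time) ss.
Qed.

Lemma smooth_penalty a N : smooth_expr (time_penalty a N).
Proof.
exact: se_mul (se_cst _) (se_exp (se_mul (se_cst _) se_time)).
Qed.

Lemma is_derive_sqdist y z v :
  is_derive z v (fun z => sqdist y z.1)
    (\sum_i 2 * (z.1 0 i - y 0 i) * v.1 0 i).
Proof.
have -> : (fun z => sqdist y z.1) =
    \sum_i (fun z => (z.1 0 i - y 0 i) ^+ 2).
  by apply/funext => w; rewrite fct_sumE.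
apply: is_derive_sum => i.
have d : is_derive z v (fun z : spacetime => z.1 0 i - y 0 i) (v.1 0 i + 0).
  exact: is_derive_add (is_derive_coord z v i) (is_derive_cst _ _ _).
apply: is_derive_eq (is_derive_mul d d) _; ring.
Qed.

Lemma is_derive_mull (c : R) f z v (df : R) : is_derive z v f df ->
  is_derive z v (fun z : spacetime => c * f z) (c * df).
Proof.
move=> d; apply: is_derive_eq (is_derive_mul (is_derive_cst c z v) d) _.
by rewrite /cst; ring.
Qed.

Lemma is_derive_penalty a N z v :
  is_derive z v (time_penalty a N) (N * time_penalty a N z * v.2).
Proof.
apply: is_derive_eq (is_derive_mull a (is_derive_expR_comp
  (is_derive_mull N (is_derive_time z v)))) _.
by rewrite /time_penalty; ring.
Qed.

Lemma is_derive_expsqdist eta b y z v :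
  is_derive z v (fun z => expR (- (b * (sqdist y z.1 - eta ^+ 2))))
    (- b * expR (- (b * (sqdist y z.1 - eta ^+ 2)))
       * (\sum_i 2 * (z.1 0 i - y 0 i) * v.1 0 i)).
Proof.
have ds := is_derive_add (is_derive_sqdist y z v)
                         (is_derive_cst (- eta ^+ 2) z v).
have de := is_derive_expR_comp (is_derive_mull (-1) (is_derive_mull b ds)).
have -> : (fun z => expR (- (b * (sqdist y z.1 - eta ^+ 2)))) =
  (fun z => expR (-1 * (b * (sqdist y z.1 + cst (- eta ^+ 2) z)))).
  by apply/funext => w; rewrite mulN1r.
apply: is_derive_eq de _; rewrite mulN1r /cst; ring.
Qed.

Lemma is_derive_barrier eta k b C y z v : b != 0 ->
  is_derive z v (barrier eta k b C y)
    (barrier_slope eta k b C y z * (\sum_i 2 * (z.1 0 i - y 0 i) * v.1 0 i)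
     + C * v.2 * (sqdist y z.1 - eta ^+ 2)).
Proof.
move=> b0.
have ds := is_derive_add (is_derive_sqdist y z v)
                         (is_derive_cst (- eta ^+ 2) z v).
have de := is_derive_mull (- b^-1) (is_derive_expsqdist eta b y z v).
have dt := is_derive_mul (is_derive_mull C (is_derive_time z v)) ds.
have d := is_derive_add (is_derive_add (is_derive_mull k ds)
  (is_derive_add (is_derive_cst b^-1 z v) de)) dt.
have E : barrier eta k b C y = (fun w : spacetime =>
   k * (sqdist y w.1 + cst (- eta ^+ 2) w)
   + (cst b^-1 w + - b^-1 * expR (- (b * (sqdist y w.1 - eta ^+ 2))))
   + C * w.2 * (sqdist y w.1 + cst (- eta ^+ 2) w)).
  by apply/funext => w; rewrite /barrier /cst; ring.
rewrite E; apply: is_derive_eq d _; rewrite /barrier_slope /cst.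
set e := expR _; set S := \sum_i _; set t := sqdist _ _; field.
exact: b0.
Qed.

End Barrier.

Section BarrierOperator.
Context {R : realType} {n : nat}.
Local Notation spacetime := ('rV[R]_n * R)%type.
Implicit Types (x y : 'rV[R]_n) (z v : spacetime).

Lemma sum_space_dir (F : 'I_n -> R) i :
  \sum_j F j * (space_dir i : spacetime).1 0 j = F i.
Proof.
rewrite (bigD1 i) //= big1 => [|j /negPf ji]; rewrite !mxE !eqxx ?ji ?mulr0 //.
by rewrite mulr1 addr0.
Qed.

(** The barrier shifted by the penalty, and by a constant [m] that will make it
    touch the solution. *)
Definition test_barrier (eta k b C a N m : R) y z : R :=
  barrier eta k b C y z + time_penalty a N z + m.

Lemma is_derive_test_barrier eta k b C a N m y z v : b != 0 ->
  is_derive z v (test_barrier eta k b C a N m y)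
    (barrier_slope eta k b C y z * (\sum_i 2 * (z.1 0 i - y 0 i) * v.1 0 i)
     + C * v.2 * (sqdist y z.1 - eta ^+ 2) + N * time_penalty a N z * v.2).
Proof.
move=> b0; apply: is_derive_eq (is_derive_add (is_derive_add
  (is_derive_barrier eta k C y z v b0) (is_derive_penalty a N z v))
  (is_derive_cst m z v)) _; exact: addr0.
Qed.

Lemma derive_space_test_barrier eta k b C a N m y z i : b != 0 ->
  'D_(space_dir i) (test_barrier eta k b C a N m y) z =
  barrier_slope eta k b C y z * (2 * (z.1 0 i - y 0 i)).
Proof.
move=> b0.
have d := is_derive_test_barrier eta k C a N m y z (space_dir i) b0.
by rewrite (@derive_val _ _ _ _ _ _ _ d) sum_space_dir /= !(mulr0, mul0r) !addr0.
Qed.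

Lemma derive_space2_test_barrier eta k b C a N m y z i : b != 0 ->
  'D_(space_dir i) ('D_(space_dir i) (test_barrier eta k b C a N m y)) z =
  2 * barrier_slope eta k b C y z
  - 4 * b * expR (- (b * (sqdist y z.1 - eta ^+ 2))) * (z.1 0 i - y 0 i) ^+ 2.
Proof.
move=> b0; rewrite (_ : 'D_(space_dir i) (test_barrier eta k b C a N m y) =
  fun w => barrier_slope eta k b C y w * (2 * (w.1 0 i - y 0 i))); last first.
  by apply/funext => w; exact: derive_space_test_barrier.
have dq := is_derive_expsqdist eta b y z (space_dir i).
have dh := is_derive_add (is_derive_add (is_derive_cst k z (space_dir i)) dq)
  (is_derive_mull C (is_derive_time z (space_dir i))).
have dc := is_derive_mull 2 (is_derive_add (is_derive_coord z (space_dir i) i)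
  (is_derive_cst (- y 0 i) z (space_dir i))).
have d := is_derive_mul dh dc.
rewrite (@derive_val _ _ _ _ _ _ _ d) sum_space_dir /= !mxE !eqxx /cst.
rewrite /barrier_slope /=; ring.
Qed.

Lemma derive_time_test_barrier eta k b C a N m y z : b != 0 ->
  'D_time_dir (test_barrier eta k b C a N m y) z =
  C * (sqdist y z.1 - eta ^+ 2) + N * time_penalty a N z.
Proof.
move=> b0.
have d := is_derive_test_barrier eta k C a N m y z time_dir b0.
rewrite (@derive_val _ _ _ _ _ _ _ d) /= big1 => [|i _]; last by rewrite mxE mulr0.
by rewrite mulr0 add0r !mulr1.
Qed.

(** [Q] bounds the slope part of [lambda] times the Laplacian, and the gradient
    term.  The two hypotheses on [Q] serve the regions [b s <= 1] and
    [b s > 1]; the penalty only makes the inequality strict. *)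
Lemma barrier_strict_supersolution (p lambda Lambda eta k b C a N m r : R) y z :
  0 <= p -> 0 <= lambda -> lambda <= Lambda ->
  0 <= k -> 0 < b -> 0 <= C -> 0 < a -> 0 < N -> 0 <= r ->
  0 <= z.2 -> C * z.2 <= 1 ->
  eta ^+ 2 <= sqdist y z.1 -> sqdist y z.1 <= r ^+ 2 ->
  let Q := 2 * n%:R * lambda * (k + 2) + (2 * (k + 2) * r) `^ p in
  Q <= 4 * lambda * eta ^+ 2 * b * expR (-1) -> Q <= C / b ->
  0 < parabolic_op p lambda Lambda (test_barrier eta k b C a N m y) z.
Proof.
move=> p0 l0 lL k0 b0 C0 a0 N0 r0 t0 Ct sy sr Q Qb QC.
have bn0 : b != 0 by rewrite gt_eqF.
set phi := test_barrier _ _ _ _ _ _ _ _.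
set s := sqdist y z.1 - eta ^+ 2.
have s0 : 0 <= s by rewrite subr_ge0.
set q := expR (- (b * s)).
have q0 : 0 < q by exact: expR_gt0.
have q1 : q <= 1 by rewrite -expR0 ler_expR oppr_le0 mulr_ge0 // ltW.
set h := barrier_slope eta k b C y z.
have hE : h = k + q + C * z.2 by [].
have h0 : 0 <= h by rewrite hE !addr_ge0 // ?(ltW q0) // mulr_ge0.
have h2 : h <= k + 2 by rewrite hE; lra.
have lap : \tr (space_hessian phi z) =
    2 * n%:R * h - 4 * b * q * sqdist y z.1.
  rewrite /mxtrace; under eq_bigr do rewrite mxE derive_space2_test_barrier //.
  rewrite big_split /= sumrN sumr_const card_ord -[_ *+ n]mulr_natl -mulr_sumr.
  by rewrite -/h -/s -/q -/(sqdist y z.1); ring.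
have grad : enorm (space_gradient phi z) <= 2 * (k + 2) * r.
  apply: enorm_le; first by rewrite !mulr_ge0 // addr_ge0.
  under eq_bigr do rewrite mxE derive_space_test_barrier // !exprMn.
  rewrite -!mulr_sumr -/(sqdist y z.1) -/h mulrA !exprMn.
  apply: ler_pM => //; rewrite ?mulr_ge0 ?sqr_ge0 //.
    by apply: sumr_ge0 => *; rewrite sqr_ge0.
  by rewrite mulrC ler_wpM2l ?sqr_ge0 // ler_sqr ?nnegrE // addr_ge0.
have gradp : enorm (space_gradient phi z) `^ p <= (2 * (k + 2) * r) `^ p.
  apply: ge0_ler_powR; rewrite ?nnegrE ?sqrtr_ge0 // !mulr_ge0 // addr_ge0 //.
have := @pucci_min_le_trace R n lambda Lambda (space_hessian phi z) l0 lL.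
rewrite lap /parabolic_op derive_time_test_barrier // -/s => pucci.
have pen : 0 < N * time_penalty a N z.
  by rewrite !mulr_gt0 // expR_gt0.
have lh : lambda * (2 * n%:R * h) <= 2 * n%:R * lambda * (k + 2).
  rewrite mulrCA mulrA [leLHS](_ : _ = 2 * n%:R * lambda * h); last by ring.
  by rewrite ler_wpM2l // !mulr_ge0.
suff main : Q <= C * s + lambda * (4 * b * q * sqdist y z.1).
  by rewrite /Q in main; lra.
have e0 : 0 <= lambda * (4 * b * q * sqdist y z.1).
  rewrite !mulr_ge0 // ?(ltW b0) ?(ltW q0) //.
  by apply: sumr_ge0 => *; rewrite sqr_ge0.
case: (leP (b * s) 1) => bs; last first.
  (* Away from the sphere the time derivative is at least C / b. *)
  rewrite (le_trans QC) // -[leLHS]addr0 lerD //.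
  by rewrite ler_wpM2l // ltW // -[_^-1]mul1r ltr_pdivrMr // mulrC.
(* Near the sphere q is at least exp (-1), so the concave term suffices. *)
rewrite (le_trans Qb) // -[leLHS]add0r lerD ?mulr_ge0 //.
rewrite [leLHS](_ : _ = lambda * (4 * b * (expR (-1) * eta ^+ 2))); last by ring.
rewrite -[4 * b * q * _]mulrA; apply: ler_wpM2l => //; apply: ler_wpM2l.
  by rewrite mulr_ge0 // ltW.
apply: ler_pM; rewrite ?expR_ge0 ?sqr_ge0 //.
by rewrite ler_expR lerN2.
Qed.

Lemma penalty_strict_subsolution (p lambda Lambda a N m : R) z :
  p != 0 -> 0 <= lambda -> lambda <= Lambda -> 0 < a -> 0 < N ->
  parabolic_op p lambda Lambda
    (fun w : spacetime => m - time_penalty a N w) z < 0.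
Proof.
move=> p0 l0 lL a0 N0.
have d w v : is_derive w v (fun w : spacetime => m - time_penalty a N w)
    (- (N * time_penalty a N w * v.2)).
  have := is_derive_add (is_derive_cst m w v)
    (is_derive_mull (-1) (is_derive_penalty a N w v)).
  rewrite add0r mulN1r (_ : (fun _ => _) = fun w : spacetime => m - time_penalty a N w) //.
  by apply/funext => x; rewrite mulN1r.
have ds i : 'D_(space_dir i) (fun w : spacetime => m - time_penalty a N w) = fun=> 0.
  apply/funext => w; rewrite (@derive_val _ _ _ _ _ _ _ (d w (space_dir i))) /=.
  by rewrite mulr0 oppr0.
rewrite /parabolic_op (@derive_val _ _ _ _ _ _ _ (d z time_dir)) /=.
have -> : space_hessian (fun w : spacetime => m - time_penalty a N w) z = 0.
  by apply/matrixP => i j; rewrite !mxE !ds; exact: derive_cst.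
have -> : space_gradient (fun w : spacetime => m - time_penalty a N w) z = 0.
  by apply/rowP => i; rewrite !mxE; exact: (congr1 (@^~ z) (ds i)).
rewrite pucci_min0 // /enorm big1 => [|i _]; last by rewrite mxE expr0n.
rewrite sqrtr0 powR0 // !subr0 mulr1 oppr_lt0.
by rewrite !mulr_gt0 // expR_gt0.
Qed.

End BarrierOperator.

(** * Penalized maxima *)

Section PenalizedMaximum.
Context {R : realType} {n : nat}.
Local Notation spacetime := ('rV[R]_n * R)%type.
Implicit Types (K D : set 'rV[R]_n) (w u phi : spacetime -> R) (z : spacetime).

Lemma continuous_penalty a N : continuous (time_penalty a N : spacetime -> R).
Proof. exact/smooth_expr_continuous/smooth_penalty. Qed.

(** Subtracting [a * exp (N t)], small at time [t1] but larger than the maximum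
    of [w] at time [T], forces the maximum of the difference to be attained
    strictly between the times 0 and [T].  An exponential is used because a
    penalty blowing up at [T] would not be smooth on the whole of
    space-time. *)
Lemma penalized_max K w (T t1 : R) (x1 : 'rV[R]_n) :
  compact K -> {within K `*` `[0, T]%classic, continuous w} ->
  (forall x, K x -> w (x, 0) <= 0) ->
  K x1 -> 0 < t1 < T -> 0 < w (x1, t1) ->
  exists a N z, [/\ 0 < a, 0 < N, K z.1, 0 < z.2 < T & time_penalty a N z < w z /\
    forall y, K y.1 -> 0 <= y.2 <= T ->
      w y - time_penalty a N y <= w z - time_penalty a N z].
Proof.
move=> cK cw w0 Kx1 /andP[t10 t1T] w1.
have T0 : 0 < T by exact: lt_trans t1T.
set A := K `*` `[0, T]%classic.
have cA : compact A by exact: compact_setX (@segment_compact _ _ _).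
have A1 : A (x1, t1) by split => //=; rewrite in_itv /= !ltW.
have [c cA' wc] := compact_EVT_max (ex_intro _ _ A1) cA cw.
set B := w c; have B0 : 0 < B by apply: lt_le_trans w1 _; exact/wc/mem_set.
(* The penalty equals e at time t1, and is at least e + B at time T. *)
set e := w (x1, t1) / 2; have e0 : 0 < e by exact: divr_gt0.
set N := B / (e * (T - t1)).
have N0 : 0 < N by rewrite divr_gt0 // mulr_gt0 // subr_gt0.
set a := e * expR (- (N * t1)); have a0 : 0 < a by rewrite mulr_gt0 // expR_gt0.
have pen x t : time_penalty a N (x : 'rV[R]_n, t) = e * expR (N * (t - t1)).
  by rewrite /time_penalty /a -mulrA -expRD /=; congr (_ * expR _); ring.
have penT x : B < time_penalty a N (x : 'rV[R]_n, T).
  rewrite pen; apply: (@lt_le_trans _ _ (e * (1 + N * (T - t1)))).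
    rewrite mulrDr mulr1 [X in _ + X](_ : _ = B); first by rewrite ltrDr.
    rewrite /N; field; apply/andP; split; last exact: lt0r_neq0.
    by rewrite subr_eq0 gt_eqF.
  by rewrite ler_wpM2l ?(ltW e0) // expR_ge1Dx.
have cwp : {within A, continuous (w - time_penalty a N)}.
  exact: within_continuousB cw (continuous_subspaceT (@continuous_penalty a N)).
have [[x t] /set_mem[/= Kx]] := compact_EVT_max (ex_intro _ _ A1) cA cwp.
rewrite in_itv /= => /andP[t0 tT] zmax.
have zmax' y : K y.1 -> 0 <= y.2 <= T ->
    w y - time_penalty a N y <= w (x, t) - time_penalty a N (x, t).
  by move=> Ky yT; apply/zmax/mem_set; split => //=; rewrite in_itv.
have pos : time_penalty a N (x, t) < w (x, t).
  rewrite -subr_gt0 (lt_le_trans _ (zmax' (x1, t1) _ _)) ?subr_gt0 //=; last first.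
    by rewrite !ltW.
  by rewrite pen subrr mulr0 expR0 mulr1 /e; lra.
have pen0 : 0 < time_penalty a N (x, t) by rewrite mulr_gt0 // expR_gt0.
exists a, N, (x, t); split => //=; apply/andP; split.
  rewrite lt_neqAle t0 andbT; apply/negP => /eqP t0'; move: pos; rewrite -t0' in pen0 *.
  by have := w0 x Kx; lra.
rewrite lt_neqAle tT andbT; apply/negP => /eqP tT'; move: pos; rewrite tT'.
have := penT x; have : w (x, T) <= B; last by lra.
by apply/wc/mem_set; split => //=; rewrite in_itv /= lexx ltW.
Qed.

Lemma near_time_lt z (T : R) : z.2 < T -> \forall y \near z, y.2 < T.
Proof. by move=> zT; exact: cvg_snd (lt_nbhsl zT). Qed.

(** A comparison valid up to a time later than that of [z] is enough, touching
    being a local condition. *)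
Lemma touches_above_of_le (S : set spacetime) u phi z (T : R) :
  z.2 < T -> phi z = u z ->
  (forall y, S y -> y.2 < T -> u y <= phi y) -> touches_above S u phi z.
Proof.
move=> zT pz le; split => //; rewrite near_withinE.
by apply: filterS (near_time_lt zT) => y yT Sy; exact: le.
Qed.

Lemma touches_below_of_le (S : set spacetime) u phi z (T : R) :
  z.2 < T -> phi z = u z ->
  (forall y, S y -> y.2 < T -> phi y <= u y) -> touches_below S u phi z.
Proof.
move=> zT pz le; split => //; rewrite near_withinE.
by apply: filterS (near_time_lt zT) => y yT Sy; exact: le.
Qed.

End PenalizedMaximum.

Section Comparison.
Context {R : realType} {n : nat}.
Local Notation spacetime := ('rV[R]_n * R)%type.
Implicit Types (Omega : set 'rV[R]_n) (u : spacetime -> R).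

Lemma bounded_closure Omega : bounded_set Omega ->
  exists2 B : R, 0 <= B & forall x, closure Omega x -> `|x| <= B.
Proof.
move=> [M [_ /(_ (`|M| + 1))]]; rewrite (le_lt_trans (ler_norm _)) ?ltrDl //.
move=> /(_ isT) hM; exists (`|M| + 1) => [|x]; first exact: addr_ge0.
have cl : closed [set x : 'rV[R]_n | `|x| <= `|M| + 1].
  apply: (@preimage_closed _ _ (fun x : 'rV[R]_n => `|x|) [set r | r <= `|M| + 1]).
    by move=> y _; exact: norm_continuous.
  exact: closed_le.
by rewrite closureE => /(_ _ (conj cl _)); apply => y /hM.
Qed.

Lemma compact_closure Omega : bounded_set Omega -> compact (closure Omega).
Proof.
move=> /bounded_closure[B B0 hB]; apply: bounded_closed_compact.
  exists B; split; first exact: num_real.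
  by move=> M BM x /hB xB; exact: le_trans (ltW BM).
exact: closed_closure.
Qed.

Lemma closure_cases Omega x : open Omega -> closure Omega x ->
  Omega x \/ boundary Omega x.
Proof.
move=> oO clx; have [Ox|nOx] := pselect (Omega x); first by left.
by right; split => // /interior_subset.
Qed.

End Comparison.

(** * Comparison *)

Section ComparisonPrinciples.
Context {R : realType} {n : nat}.
Local Notation spacetime := ('rV[R]_n * R)%type.
Implicit Types (Omega : set 'rV[R]_n) (u : spacetime -> R).

(** Comparison with 0: at a negative penalized minimum, on the boundary as in
    the interior, the test function [m - a * exp (N t)] would have to be a
    supersolution. *)
Lemma viscosity_solution_ge0 (p lambda Lambda : R) Omega (T : R)
    (u0 : 'rV[R]_n -> R) u :
  p != 0 -> 0 <= lambda -> lambda <= Lambda ->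
  open Omega -> bounded_set Omega ->
  viscosity_solution p lambda Lambda Omega T u0 u ->
  (forall x, closure Omega x -> 0 <= u0 x) ->
  forall x t, closure Omega x -> 0 < t < T -> 0 <= u (x, t).
Proof.
move=> p0 l0 lL oO bO [cu eqn bnd ini] u0_ge0 x t clx /andP[t0 tT].
rewrite leNgt; apply/negP => uneg.
set T' := (t + T) / 2.
have tT' : t < T' by rewrite /T'; lra.
have T'T : T' < T by rewrite /T'; lra.
have cw : {within closure Omega `*` `[0, T']%classic, continuous (cst 0 - u)}.
  apply: within_continuousB; first exact/continuous_subspaceT/cst_continuous.
  apply: continuous_subspaceW cu => -[y s] [/= cly].
  rewrite !in_itv /= => /andP[-> sT]; split => //=; exact: le_lt_trans sT T'T.
have E y : (cst 0 - u) y = - u y by rewrite /GRing.add /= /cst; exact: add0r.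
have [||||a [N [z [a0 N0 clz /andP[z0 zT'] [zpos zmax]]]]] :=
    penalized_max (compact_closure bO) cw (t1 := t) (x1 := x).
- by move=> y cly; rewrite E ini // oppr_le0 u0_ge0.
- exact: clx.
- by rewrite t0.
- by rewrite E oppr_gt0.
have pen0 : 0 < time_penalty a N z by rewrite mulr_gt0 // expR_gt0.
rewrite E in zpos.
pose m := u z + time_penalty a N z.
pose phi := fun y : spacetime => m - time_penalty a N y.
have sphi : smooth phi.
  exact/smooth_expr_smooth/(se_add (se_cst _))/se_opp/smooth_penalty.
have phiz : phi z = u z by rewrite /phi /m addrK.
have phi_le y : closure Omega y.1 -> 0 <= y.2 -> y.2 < T' -> phi y <= u y.
  move=> cly y0 yT; have := zmax y cly; rewrite !E y0 ltW // => /(_ isT).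
  by rewrite /phi /m; lra.
have op : parabolic_op p lambda Lambda phi z < 0.
  exact: penalty_strict_subsolution.
have zI : `]0, T[%classic z.2 by rewrite /= in_itv /= z0 (lt_trans zT').
have [Oz|Bz] := closure_cases oO clz.
- have [|_ /(_ _)] := eqn z _ phi sphi; first by split.
  rewrite leNgt op => /(_ _)/negP; apply => //.
  apply: touches_below_of_le zT' phiz _ => y [/= Oy].
  rewrite in_itv /= => /andP[y0 _] yT; apply: phi_le => //; last exact: ltW.
  exact: subset_closure.
- have [|_ /(_ _)] := bnd z _ phi sphi; first by split.
  rewrite le_max !leNgt op /= => /(_ _)/negP; apply; last by lra.
  apply: touches_below_of_le zT' phiz _ => y [/= Oy].
  by rewrite in_itv /= => /andP[y0 _] yT; apply: phi_le => //; exact: ltW.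
Qed.

(** Comparison with the barrier.  At a positive penalized maximum of
    [u - barrier] lying on the boundary, [u] is positive because the barrier is
    nonnegative; so the boundary condition still gives the subsolution
    inequality, which the barrier violates. *)
Lemma viscosity_solution_le_barrier (p lambda Lambda : R) Omega (T : R)
    (u0 : 'rV[R]_n -> R) u
    (eta k b C r : R) y0 :
  0 <= p -> 0 <= lambda -> lambda <= Lambda ->
  open Omega -> bounded_set Omega ->
  viscosity_solution p lambda Lambda Omega T u0 u ->
  0 <= k -> 0 < b -> 0 <= C -> 0 <= r -> C * T <= 1 ->
  (forall x, closure Omega x -> eta ^+ 2 <= sqdist y0 x <= r ^+ 2) ->
  (forall x, closure Omega x -> u0 x <= k * (sqdist y0 x - eta ^+ 2)) ->
  let Q := 2 * n%:R * lambda * (k + 2) + (2 * (k + 2) * r) `^ p in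
  Q <= 4 * lambda * eta ^+ 2 * b * expR (-1) -> Q <= C / b ->
  forall x t, closure Omega x -> 0 < t < T ->
    u (x, t) <= barrier eta k b C y0 (x, t).
Proof.
move=> p0 l0 lL oO bO [cu eqn bnd ini] k0 b0 C0 r0 CT geo u0_le Q Qb QC x t clx.
move=> /andP[t0 tT]; rewrite leNgt; apply/negP => ubig.
set T' := (t + T) / 2.
have tT' : t < T' by rewrite /T'; lra.
have T'T : T' < T by rewrite /T'; lra.
set psi := barrier eta k b C y0.
have psi_ge y : closure Omega y.1 -> 0 <= y.2 ->
    k * (sqdist y0 y.1 - eta ^+ 2) <= psi y.
  move=> /geo /andP[sy _] yt; have s0 : 0 <= sqdist y0 y.1 - eta ^+ 2 by lra.
  rewrite /psi /barrier -addrA lerDl addr_ge0 //; last by rewrite !mulr_ge0.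
  rewrite divr_ge0 ?(ltW b0) // subr_ge0 -expR0 ler_expR oppr_le0.
  by rewrite mulr_ge0 // ltW.
have psi_ge0 y : closure Omega y.1 -> 0 <= y.2 -> 0 <= psi y.
  move=> cly yt; apply: le_trans (psi_ge y cly yt).
  by have /andP[sy _] := geo _ cly; rewrite mulr_ge0 // subr_ge0.
have cw : {within closure Omega `*` `[0, T']%classic, continuous (u - psi)}.
  apply: within_continuousB; last first.
    exact/continuous_subspaceT/smooth_expr_continuous/smooth_barrier.
  apply: continuous_subspaceW cu => -[y s] [/= cly].
  rewrite !in_itv /= => /andP[-> sT]; split => //=; exact: le_lt_trans sT T'T.
have E y : (u - psi) y = u y - psi y by [].
have [||||a [N [z [a0 N0 clz /andP[z0 zT'] [zpos zmax]]]]] :=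
    penalized_max (compact_closure bO) cw (t1 := t) (x1 := x).
- move=> y cly; rewrite E ini // subr_le0 (le_trans (u0_le _ cly)) //.
  exact: (psi_ge (y, 0)).
- exact: clx.
- by rewrite t0.
- by rewrite E subr_gt0.
have pen0 : 0 < time_penalty a N z by rewrite mulr_gt0 // expR_gt0.
have uz0 : 0 < u z.
  by move: zpos; rewrite E; have := psi_ge0 z clz (ltW z0); lra.
pose m := u z - psi z - time_penalty a N z.
pose phi := test_barrier eta k b C a N m y0.
have sphi : smooth phi.
  apply/smooth_expr_smooth/(se_add _ (se_cst _))/se_add/smooth_penalty.
  exact: smooth_barrier.
have phiz : phi z = u z by rewrite /phi /test_barrier /m -/psi; ring.
have phi_ge y : closure Omega y.1 -> 0 <= y.2 -> y.2 < T' -> u y <= phi y.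
  move=> cly y_ge0 yT; have := zmax y cly; rewrite !E y_ge0 ltW // => /(_ isT).
  by rewrite /phi /test_barrier /m -/psi; lra.
have op : 0 < parabolic_op p lambda Lambda phi z.
  have /andP[geo1 geo2] := geo _ clz.
  apply: (@barrier_strict_supersolution _ _ _ _ _ _ _ _ _ _ _ _ r) => //.
    exact: ltW.
  by apply: le_trans CT; rewrite ler_wpM2l // ltW // (lt_trans zT').
have zI : `]0, T[%classic z.2 by rewrite /= in_itv /= z0 (lt_trans zT').
have [Oz|Bz] := closure_cases oO clz.
- have [|/(_ _) + _] := eqn z _ phi sphi; first by split.
  rewrite leNgt op => /(_ _)/negP; apply => //.
  apply: touches_above_of_le zT' phiz _ => y [/= Oy].
  rewrite in_itv /= => /andP[y_gt0 _] yT; apply: phi_ge => //; last exact: ltW.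
  exact: subset_closure.
- have [|/(_ _) + _] := bnd z _ phi sphi; first by split.
  rewrite ge_min !leNgt op uz0 => /(_ _)/negP; apply => //.
  apply: touches_above_of_le zT' phiz _ => y [/= Oy].
  by rewrite in_itv /= => /andP[y_gt0 _] yT; apply: phi_ge => //; exact: ltW.
Qed.

End ComparisonPrinciples.

(** * The initial datum along segments to an exterior ball *)

Section InitialDatum.
Context {R : realType} {n : nat}.
Implicit Types (Omega : set 'rV[R]_n) (x y v : 'rV[R]_n) (f : 'rV[R]_n -> R).

Lemma derive_le_gradient f x v : differentiable f x ->
  'D_v f x <= enorm (gradient f x) * enorm v.
Proof.
move=> df; apply: le_trans (dot_le_enorm _ _).
rewrite deriveE // {1}(row_sum_delta v) linear_sum /=.
apply: ler_sum => i _; rewrite linearZ /= mxE deriveE //.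
by rewrite mulrC.
Qed.

(** The parameters between 0 and 1 whose point is outside [Omega] form a compact
    set; [t] is its least element. *)
Lemma first_exit Omega x y : open Omega -> Omega x -> ~ Omega y ->
  exists t : R, [/\ 0 < t <= 1, boundary Omega (x + t *: (y - x)) &
    forall s, 0 <= s < t -> Omega (x + s *: (y - x))].
Proof.
move=> oO Ox nOy; pose gam (s : R) := x + s *: (y - x).
have cgam : continuous gam.
  move=> s; apply: cvgD; first exact: cvg_cst.
  exact: scalel_continuous.
have gam0 : gam 0 = x by rewrite /gam scale0r addr0.
have gam1 : gam 1 = y by rewrite /gam scale1r addrC subrK.
pose E := `[0, 1]%classic `&` gam @^-1` (~` Omega).
have cE : compact E.
  apply: compact_closedI; first exact: segment_compact.
  apply: preimage_closed; first by move=> s _; exact: cgam.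
  exact: open_closedC.
have E1 : E 1 by split; rewrite /= ?in_itv /= ?ler01 ?lexx // gam1.
have cid : continuous (fun s : R => s) by move=> s; exact: cvg_id.
have [t /set_mem[/= +] nOt tmin] := compact_EVT_min (ex_intro _ _ E1) cE
  (continuous_subspaceT cid).
rewrite in_itv /= => /andP[t0 t1].
have t_gt0 : 0 < t.
  rewrite lt_neqAle t0 andbT; apply/negP => /eqP t0'; apply: nOt.
  by rewrite -t0' gam0.
have before s : 0 <= s < t -> Omega (gam s).
  move=> /andP[s0 st]; apply: contrapT => nOs.
  have : t <= s.
    apply/tmin/mem_set; split => //=; rewrite in_itv /= s0.
    exact: le_trans (ltW st) t1.
  by rewrite leNgt st.
exists t; split => //; first by rewrite t_gt0.
split; last by move=> /interior_subset.
move=> B nB; have := cgam t _ nB; rewrite near_simpl /= => -[e /= e0 eB].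
pose s := Num.max 0 (t - e / 2).
have s0 : 0 <= s by rewrite le_max lexx.
have st : s < t by rewrite gt_max t_gt0 /=; lra.
exists (gam s); split; first by apply: before; rewrite s0.
apply: eB; rewrite /= gtr0_norm ?subr_gt0 //.
have : t - e / 2 <= s by rewrite le_max lexx orbT.
by lra.
Qed.

(** The supremum defining the norm is over a bounded set, because the gradient
    extends continuously to the compact closure. *)
Lemma C1_norm_ge_gradient Omega f x : bounded_set Omega -> C1_closure Omega f ->
  Omega x -> enorm (gradient f x) <= C1_norm Omega f.
Proof.
move=> bO [_ _ [g cg gradE]] Ox.
have /compact_bounded[M [_ /(_ (`|M| + 1))]] :=
  continuous_compact cg (compact_closure bO).
rewrite (le_lt_trans (ler_norm _)) ?ltrDl // => /(_ isT) hM.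
rewrite /C1_norm -[leLHS]add0r lerD //.
  set S := [set _ | _ in _].
  have [hS|nS] := pselect (has_sup S); last by rewrite sup_out.
  have [_ [y cly _]] := hS.1.
  exact: le_trans (normr_ge0 _) (sup_upper_bound hS (ex_intro2 _ _ y cly erefl)).
apply: ub_le_sup; last by exists x.
exists (n%:R * (`|M| + 1)) => _ [y Oy <-].
apply: enorm_le_entry => [i|]; last exact: addr_ge0.
rewrite gradE //; apply: le_trans (entry_le_norm _ _) _.
by apply: hM; exists y => //; exact: subset_closure.
Qed.

(** Follow the segment from [x] to the centre [y] of the ball.  It leaves
    [Omega] at a boundary point, where [f = 0], before it enters the ball, hence within
    distance [enorm (x - y) - eta] of [x]; the mean value theorem applies up to
    there. *)
Lemma C1_le_exterior_ball Omega f (eta : R) x y :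
  open Omega -> bounded_set Omega -> C1_closure Omega f ->
  (forall z, boundary Omega z -> f z = 0) ->
  0 < eta -> eball y eta `<=` ~` closure Omega ->
  Omega x -> f x <= C1_norm Omega f * (enorm (x - y) - eta).
Proof.
move=> oO bO C1f f0 eta0 ext Ox.
have far z : closure Omega z -> eta <= enorm (z - y).
  by move=> clz; rewrite leNgt; apply/negP => /ext; apply.
have nOy : ~ Omega y.
  move=> /subset_closure /far; rewrite subrr leNgt => /negP; apply.
  by rewrite /enorm big1 ?sqrtr0 // => i _; rewrite mxE expr0n.
have [t [/andP[t0 t1] Bt before]] := first_exit oO Ox nOy.
pose v := y - x; pose gam (s : R) := x + s *: v.
have [cf df _] := C1f.
have gamB (s h : R) : h *: v + gam s = gam (h + s).
  by rewrite /gam scalerDl addrCA.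
have dgam s : s \in `]0, t[ -> is_derive s 1 (f \o gam) ('D_v f (gam s)).
  rewrite in_itv /= => /andP[s0 st].
  have /(@diff_derivable _ _ _ _ _ v)/derivableP/is_derive_line d :
      differentiable f (gam s).
    by apply/df/before; rewrite ltW.
  have -> : f \o gam = (fun h : R => f (h *: v + gam s)) \o (fun h => h - s).
    by apply/funext => h /=; rewrite gamB subrK.
  have ds : is_derive s (1 : R) (fun h : R => h - s) 1.
    by apply: is_derive_eq (is_derive_add (is_derive_id s 1)
      (is_derive_cst (- s) s 1)) (addr0 _).
  rewrite -['D_v f _]mulr1.
  apply: (@is_derive1_comp R (fun h : R => f (h *: v + gam s))
    (fun h : R => h - s)) => //.
  by rewrite subrr.
have gamcl s : 0 <= s <= t -> closure Omega (gam s).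
  move=> /andP[s0]; rewrite le_eqVlt => /predU1P[->|st]; first by have [] := Bt.
  by apply/subset_closure/before; rewrite s0.
have cgam : continuous gam.
  by move=> s; apply: cvgD; [exact: cvg_cst | exact: scalel_continuous].
have cfg : {within `[0, t]%classic, continuous (f \o gam)}.
  apply/subspace_continuousP => s; rewrite /= in_itv /= => sI P nP.
  have [+ _] := subspace_continuousP (closure Omega) f.
  move=> /(_ cf _ (gamcl s sI) P nP) near_f.
  have : nbhs (gam s) [set z | closure Omega z -> P (f z)] := near_f.
  move=> /(cgam s) near_g.
  have near_fgam : nbhs s (gam @^-1` [set z | closure Omega z -> P (f z)]).
    exact: near_g.
  suff : nbhs s [set h | `[0, t]%classic h -> P (f (gam h))] by [].
  apply: filterS near_fgam => h hP; rewrite /= in_itv /= => hI.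
  exact/hP/gamcl.
have [c] := MVT t0 dgam cfg.
rewrite in_itv /= => /andP[c0 ct].
have Oc : Omega (gam c) by apply: before; rewrite ltW.
rewrite /gam /= scale0r addr0 (f0 _ Bt) -/gam sub0r subr0 => mvt.
set M := C1_norm Omega f.
have M0 : 0 <= M := le_trans (enorm_ge0 _) (C1_norm_ge_gradient bO C1f Ox).
have dv : - 'D_v f (gam c) <= M * enorm (x - y).
  have -> : - 'D_v f (gam c) = 'D_(x - y) f (gam c).
    by rewrite !(deriveE _ (df _ Oc)) -linearN /v opprB.
  apply: le_trans (derive_le_gradient _ (df _ Oc)) _.
  by rewrite ler_wpM2r ?enorm_ge0 // C1_norm_ge_gradient.
have exit_far : eta <= (1 - t) * enorm (x - y).
  rewrite -enormZ ?subr_ge0 // (_ : (1 - t) *: (x - y) = x + t *: v - y).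
    by apply: far; have [] := Bt.
  by rewrite /v scalerBl scale1r -[y - x]opprB scalerN addrAC.
have -> : f x = - 'D_v f (gam c) * t by rewrite mulNr -mvt opprK.
apply: (@le_trans _ _ (M * enorm (x - y) * t)); first by rewrite ler_wpM2r // ltW.
by rewrite -mulrA ler_wpM2l //; lra.
Qed.
End InitialDatum.

(** * Boundary values for a short time *)

Section ExteriorBall.
Context {R : realType} {n : nat}.
Implicit Types (Omega : set 'rV[R]_n) (x y : 'rV[R]_n).

Lemma closure_eball_enorm_le x y (eta : R) : 0 <= eta ->
  closure (eball y eta) x -> enorm (x - y) <= eta.
Proof.
move=> eta0; suff cl : closed [set z : 'rV[R]_n | sqdist y z <= eta ^+ 2].
  rewrite closureE => /(_ _ (conj cl _)) /= xy.
  rewrite -ler_sqr ?nnegrE ?enorm_ge0 // -sqdistE; apply: xy => z /= yz.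
  by rewrite sqdistE ler_sqr ?nnegrE ?enorm_ge0 // ltW.
apply: (@preimage_closed _ _ (sqdist y) [set r | r <= eta ^+ 2]); last first.
  exact: closed_le.
move=> z _; apply: (@continuous_comp _ _ _ (fun z : 'rV[R]_n => (z, 0 : R))
  (fun w : 'rV[R]_n * R => sqdist y w.1)).
  exact: (@cvg_pair _ _ _ _ (nbhs z) (nbhs (0 : R)) _ _ _ id (cst 0)
    cvg_id (@cvg_cst _ _ _ _ _)).
exact/smooth_expr_continuous/smooth_sqdist.
Qed.

Lemma exterior_ball_far Omega x y (eta : R) :
  eball y eta `<=` ~` closure Omega -> closure Omega x -> eta <= enorm (x - y).
Proof. by move=> ext clx; rewrite leNgt; apply/negP => /ext; apply. Qed.

End ExteriorBall.

Theorem theorem1p1 (R : realType) (n : nat) (p lambda Lambda : R)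
    (Omega : set 'rV[R]_n) :
  2 < p -> 0 < lambda -> lambda < Lambda ->
  bounded_domain Omega ->
  uniform_interior_sphere Omega -> uniform_exterior_sphere Omega ->
  exists Tstar : R -> R,
    (forall M, 0 < Tstar M) /\
    forall u0 : 'rV[R]_n -> R,
      C1_closure Omega u0 ->
      (forall x, closure Omega x -> 0 <= u0 x) ->
      (forall x, boundary Omega x -> u0 x = 0) ->
      forall u : 'rV[R]_n * R -> R,
        viscosity_solution p lambda Lambda Omega
          (Tstar (C1_norm Omega u0)) u0 u ->
        (forall x t, boundary Omega x -> 0 < t < Tstar (C1_norm Omega u0) ->
           u (x, t) = 0) /\
        (forall x, closure Omega x -> u (x, 0) = u0 x).
Proof.
move=> p2 l0 lL [oO _ _ bO] _ [eta eta0 ext].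
have [B B0 hB] := bounded_closure bO.
(* x ranges over the closure and y is at distance eta of it, so r bounds
   |x - y| uniformly in the boundary point. *)
pose r := n%:R * (B + (B + eta)).
have r0 : 0 <= r by rewrite mulr_ge0 // !addr_ge0 // ltW.
pose k (M : R) := `|M| / (2 * eta).
pose Q (M : R) := 2 * n%:R * lambda * (k M + 2) + (2 * (k M + 2) * r) `^ p.
(* The exponent b gives 4 lambda eta^2 b / e = Q + 1, and then C / b = Q + 1. *)
pose b (M : R) := (Q M + 1) * expR 1 / (4 * lambda * eta ^+ 2).
pose C (M : R) := (Q M + 1) * b M.
have k0 M : 0 <= k M by rewrite divr_ge0 // mulr_ge0 // ltW.
have Q0 M : 0 <= Q M.
  by rewrite addr_ge0 ?powR_ge0 // !mulr_ge0 ?addr_ge0 // ltW.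
have Q1 M : 0 < Q M + 1 by rewrite ltr_pwDr.
have b0 M : 0 < b M.
  by rewrite divr_gt0 // ?mulr_gt0 ?expR_gt0 // exprn_gt0.
have C0 M : 0 < C M by rewrite mulr_gt0.
exists (fun M => (C M)^-1); split=> [M|u0 C1u0 u0_ge0 u0_bd u sol].
  by rewrite invr_gt0.
set M := C1_norm Omega u0 in sol *.
split; last by case: sol.
move=> x t Bx tT; have clx : closure Omega x by case: Bx.
have [y ball_out [ball_x _]] := ext x Bx.
have far z : closure Omega z -> eta <= enorm (z - y).
  exact: exterior_ball_far.
have xy : enorm (x - y) = eta.
  by apply/le_anti; rewrite far // closure_eball_enorm_le // ltW.
have u_ge0 : 0 <= u (x, t).
  apply: viscosity_solution_ge0 sol u0_ge0 _ _ clx tT => //; rewrite ?ltW //.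
  by rewrite gt_eqF // (lt_trans _ p2).
have near_y z : closure Omega z -> enorm (z - y) <= r.
  move=> clz; apply: enorm_le_entry => [i|]; last by rewrite !addr_ge0 // ltW.
  have -> : (z - y) 0 i = z 0 i - (x 0 i - (x - y) 0 i) by rewrite !mxE; ring.
  rewrite (le_trans (ler_normB _ _)) // lerD //.
    exact: le_trans (entry_le_norm _ _) (hB _ clz).
  rewrite (le_trans (ler_normB _ _)) // lerD //.
    exact: le_trans (entry_le_norm _ _) (hB _ clx).
  rewrite -xy /enorm -sqrtr_sqr ler_wsqrtr // (bigD1 i) //= lerDl.
  by apply: sumr_ge0 => j _; rewrite sqr_ge0.
have u0_le z : closure Omega z -> u0 z <= k M * (sqdist y z - eta ^+ 2).
  move=> clz; have rho := far _ clz; rewrite sqdistE.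
  have s0 : 0 <= enorm (z - y) ^+ 2 - eta ^+ 2.
    by rewrite subr_ge0 ler_sqr ?nnegrE ?enorm_ge0 // ltW.
  have [Oz|/u0_bd ->] := closure_cases oO clz; last by rewrite mulr_ge0.
  apply: le_trans (C1_le_exterior_ball oO bO C1u0 u0_bd eta0 ball_out Oz) _.
  apply: (@le_trans _ _ (`|M| * (enorm (z - y) - eta))).
    by rewrite ler_wpM2r ?ler_norm // subr_ge0.
  rewrite /k -mulrA ler_wpM2l // mulrC ler_pdivlMr ?mulr_gt0 //.
  by rewrite subr_sqr ler_wpM2l ?subr_ge0 //; lra.
have u_le : u (x, t) <= barrier eta (k M) (b M) (C M) y (x, t).
  apply: (viscosity_solution_le_barrier (r := r) _ _ _ oO bO sol) => //.
  - by rewrite (le_trans _ (ltW p2)).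
  - exact: ltW.
  - exact: ltW.
  - exact: ltW.
  - by rewrite mulfV // gt_eqF.
  - move=> z clz; rewrite sqdistE !ler_sqr ?nnegrE ?enorm_ge0 ?(ltW eta0) //.
    by rewrite far // near_y.
  - rewrite -/(Q M) [leRHS](_ : _ = Q M + 1) ?lerDl //.
    rewrite /b expRN; field.
    by rewrite !(gt_eqF eta0, gt_eqF l0) gt_eqF // expR_gt0.
  - by rewrite -/(Q M) /C mulfK ?lerDl // gt_eqF.
apply/le_anti; rewrite u_ge0 andbT (le_trans u_le) //.
by rewrite /barrier /= sqdistE xy subrr !mulr0 oppr0 expR0 subrr mul0r !addr0.
Qed.
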